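(* Let $0<\alpha<1$, let $T=T_\alpha:[0,1)\to[0,1)$ be the intermittent map and let $\mu$ be its absolutely continuous invariant probability measure. Let $0<\alpha_1<\alpha$ and write $K_n=\lfloor n^{\alpha_1}\rfloor$. Then for $\mu$-almost every $x\in[0,1)$, $$\lim_{n\to\infty}\frac{\max\{S_{K_n}(\chi_{I_0})(T^i(x)):\ 0\le i\le n-K_n\}}{K_n}=1,$$ where $i$ ranges over integers.
   Context: For $0<\alpha<1$ the intermittent map $T=T_\alpha:[0,1)\to[0,1)$ is defined by $T_\alpha(x)=x(1+2^\alpha x^\alpha)$ if $0\le x<1/2$, and $T_\alpha(x)=2x-1$ if $1/2\le x<1$. It is known that $T_\alpha$ has a unique invariant probability measure absolutely continuous with respect to Lebesgue measure; this measure is denoted $\mu$. Let $I_0=[0,1/2)$, let $\chi_{I_0}$ be its indicator function, and for integers $n\ge1$ let $S_n(\chi_{I_0})(x)=\sum_{i=0}^{n-1}\chi_{I_0}(T^i(x))$, the number of $0\le i\le n-1$ with $T^i(x)\in I_0$. *)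

(* Defs.v *)
From HB Require Import structures.
From mathcomp Require Import all_boot all_order all_algebra.
From mathcomp Require Import all_classical all_reals all_analysis.

Set Implicit Arguments.
Unset Strict Implicit.
Unset Printing Implicit Defensive.

Import Order.TTheory GRing.Theory Num.Theory.
Import numFieldNormedType.Exports.

Local Open Scope classical_set_scope.
Local Open Scope ring_scope.

Section Intermittent.
Context {R : realType}.

(* The self-map of [0, 1[, given as a function on R; only its values on [0, 1[
   are meaningful. *)
Definition intermittent (a x : R) : R :=
  if x < 2^-1 then x * (1 + 2 `^ a * x `^ a) else 2 * x - 1.

(* Borel probability measures on [0, 1[ are represented by probabilities on R
   that give mass 1 to [0, 1[. *)
Definition acip (T : R -> R) (mu : probability (measurableTypeR R) R) : Prop :=
  [/\ mu `[(0 : R), 1[%classic = 1%E,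
      mu `<< @lebesgue_measure R &
      forall A : set (measurableTypeR R), measurable A -> A `<=` `[(0 : R), 1[ ->
        mu (`[(0 : R), 1[ `&` T @^-1` A) = mu A].

Definition birkhoff_sum (T : R -> R) (f : R -> R) (n : nat) (x : R) : R :=
  \sum_(i < n) f (iter i T x).

Definition I0 : set R := `[0, 2^-1[%classic.

(* The maximum of S_k(chi_{I_0})(T^i x) over 0 <= i <= n - k. The sums are
   nonnegative, so the default value 0 does not affect the maximum; n - k is
   truncated, which is harmless when k <= n. *)
Definition max_birkhoff_sum (T : R -> R) (n k : nat) (x : R) : R :=
  \big[Num.max/0]_(i < (n - k).+1) birkhoff_sum T \1_I0 k (iter i T x).

Definition window (b : R) (n : nat) : nat := Num.truncn (n%:R `^ b).

End Intermittent.

(* Main.v *)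
Require Import Defs.
From HB Require Import structures.
From mathcomp Require Import all_boot all_order all_algebra.
From mathcomp Require Import all_classical all_reals all_analysis.
From mathcomp Require Import ring lra zify.

Import Order.TTheory GRing.Theory Num.Theory.
Import numFieldNormedType.Exports.

Local Open Scope classical_set_scope.
Local Open Scope ring_scope.

(** The ratio is at most [1], and it equals [1] as soon as one of the points
    [x, T x, ..., T^(n - K_n) x] starts a run of [K_n] visits to [[0, 1/2)].
    As [mu] is absolutely continuous, it is enough that for Lebesgue-almost
    every [x] such a run exists for all large [n]. By the Borel-Cantelli lemma
    this follows once the Lebesgue measures of the sets [no_left_run K_n n] of
    points without a run are summable.

    Both branches of [T] map onto [[0, 1)]. Let [h] be a composition of inverse
    branches ending (innermost) with the right one; its image is a cylinder, the
    points of which have just left [[1/2, 1)], and [h'] is the density, up to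
    normalization, of the current position of a point of that cylinder. The
    left branch is convex, so [h'] is nonincreasing. Moreover
    [x^(1 + alpha) * h'(x)] is nondecreasing: precomposition with either inverse
    branch preserves this property ([admissible_left], [admissible_right]).
    Together these bound the distortion on [[1/2, 1)] by [2^(1 + alpha) <= 4],
    so that, given any past that ends in [[1/2, 1)], the position is in
    [[0, a)] with conditional probability between [a] and [4 * a]
    ([admissible_start], [mild_start_right]).

    Let [a_k] be the [k]-th preimage of [1] under the left branch; [k]
    successive positions, counted from the current one, are all in [[0, 1/2)]
    exactly when the current one is in [[0, a_k)]. Each time the orbit leaves [[1/2, 1)] it starts a run of length
    at least [K] with conditional probability at least [a_K], and the expected
    duration of a run truncated at [K] is at most [4 * M_K], where [M_K] is the
    sum of the [a_k] for [k < K]. Conditioning on the first visit to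
    [[1/2, 1)], an induction on [n] turns this into an exponential bound
    ([no_left_run_cover], [no_left_run_measure]): with
    [t = a_K / (8 * M_K)], the set of points without a run has measure at most
    [2 * exp (- t * n)].

    Finally [a_K] is at least of order [K^(- 1 / alpha)], while
    [a_k <= 1 / (k + 1)] gives [M_K <= 1 + ln K]. For [K = K_n] of order
    [n^alpha1] the exponent [t * n] is at least of order
    [n^(1 - alpha1 / alpha) / ln n], which is eventually larger than
    [2 * ln (n + 2)] because [alpha1 < alpha] ([run_rate_eventually]); the
    measures are then dominated by a multiple of [(n + 2)^-2]. *)

Section LongLeftRuns.
Set Implicit Arguments.
Unset Strict Implicit.
Context {R : realType} {alpha : R}.
Context (alpha_gt0 : 0 < alpha) (alpha_lt1 : alpha < 1).
Local Notation T := (@intermittent R alpha).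

(** * The left branch and the inverse branches *)

(** Up to rearrangement, the graph of [y^(1 + alpha)] lies above its tangent
    at [x]. This is Young's inequality for the product [y * x^alpha] with
    exponents [1 + alpha] and [(1 + alpha) / alpha]; it holds at [0] too. *)
Lemma powR_tangent (x y : R) : 0 <= x -> 0 <= y ->
  (1 + alpha) * (x `^ alpha * y) <= y * y `^ alpha + alpha * (x * x `^ alpha).
Proof.
move=> x0 y0.
have a1_gt0 : 0 < 1 + alpha by rewrite addr_gt0.
have := @conjugate_powR R y (x `^ alpha) (1 + alpha) ((1 + alpha) / alpha)
  y0 (powR_ge0 _ _) a1_gt0 (divr_gt0 a1_gt0 alpha_gt0).
have -> : (1 + alpha)^-1 + ((1 + alpha) / alpha)^-1 = 1.
  by field; rewrite !gt_eqF.
move=> /(_ erefl); rewrite -powRrM.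
have -> : alpha * ((1 + alpha) / alpha) = 1 + alpha by field; rewrite gt_eqF.
have pD z : 0 <= z -> z `^ (1 + alpha) = z * z `^ alpha.
  by move=> z0; rewrite powRD ?powRr1// gt_eqF.
rewrite !pD// => H.
have := ler_wpM2l (ltW a1_gt0) H.
have -> : (1 + alpha) * (y * y `^ alpha / (1 + alpha) +
  x * x `^ alpha / ((1 + alpha) / alpha)) =
  y * y `^ alpha + alpha * (x * x `^ alpha) by field; rewrite !gt_eqF.
by rewrite (mulrC y).
Qed.

Lemma powRW (x y : R) : 0 <= x -> x <= y -> x `^ alpha <= y `^ alpha.
Proof.
move=> x0 xy; apply: ge0_ler_powR; rewrite ?nnegrE//; first exact: ltW.
exact: le_trans xy.
Qed.

Definition left_branch (x : R) := x * (1 + 2 `^ alpha * x `^ alpha).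
Definition left_slope (x : R) := 1 + (1 + alpha) * (2 `^ alpha * x `^ alpha).

Lemma left_slope_ge1 x : 1 <= left_slope x.
Proof.
by rewrite /left_slope lerDl !mulr_ge0 ?powR_ge0// ltW// addr_gt0.
Qed.

(** Convexity of the left branch. Exchanging [x] and [y] gives the upper bound
    [left_slope y * (y - x)] for the same increment. *)
Lemma left_branch_secant x y : 0 <= x -> 0 <= y ->
  left_slope x * (y - x) <= left_branch y - left_branch x.
Proof.
move=> x0 y0.
have := ler_wpM2l (powR_ge0 2 alpha) (powR_tangent x0 y0).
rewrite /left_slope /left_branch.
move: (2 `^ alpha) (x `^ alpha) (y `^ alpha) => c u v H.
lra.
Qed.

Lemma left_branch_lt x y : 0 <= x -> x < y -> left_branch x < left_branch y.
Proof.
move=> x0 xy; rewrite -subr_gt0.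
apply: lt_le_trans (left_branch_secant x0 _); last exact: le_trans (ltW xy).
by rewrite mulr_gt0 ?subr_gt0// (lt_le_trans ltr01)// left_slope_ge1.
Qed.

Lemma left_branch_half : left_branch 2^-1 = 1.
Proof.
rewrite /left_branch -powRM ?invr_ge0// mulfV// powR1; lra.
Qed.

Lemma left_branch0 : left_branch 0 = 0.
Proof. by rewrite /left_branch mul0r. Qed.

Lemma left_branch_continuous : {within `[0, 2^-1], continuous left_branch}.
Proof.
have half0 : (0 : R) < 2^-1 by rewrite invr_gt0.
have cpos x : 0 < x -> {for x, continuous left_branch}.
  move=> x0; apply: cvgM; first exact: cvg_id.
  apply: cvgD; first exact: cvg_cst.
  apply: cvgM; first exact: cvg_cst.
  have [dx _] := is_derive1_powR alpha x0.
  by move/derivable1_diffP: dx => /differentiable_continuous.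
apply/continuous_within_itvP => //; split.
- by move=> x; rewrite in_itv/= => /andP[x0 _]; exact: cpos.
- rewrite left_branch0.
  rewrite -[X in _ --> X](mul0r (1 + 2 `^ alpha * 0)).
  apply: cvgM; first exact: cvg_at_right_filter cvg_id.
  apply: cvgD; first exact: cvg_cst.
  apply: cvgM; first exact: cvg_cst.
  exact: powR_cvg0.
- by apply: cvg_at_left_filter; exact: cpos.
Qed.

Definition left_inverse (x : R) : R :=
  xget 0 [set y | 0 <= y <= 2^-1 /\ left_branch y = x].

Lemma left_inverseP x : 0 <= x <= 1 ->
  0 <= left_inverse x <= 2^-1 /\ left_branch (left_inverse x) = x.
Proof.
move=> x01.
have half0 : (0 : R) <= 2^-1 by rewrite invr_ge0.
have xI : Num.min (left_branch 0) (left_branch 2^-1) <= x <=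
    Num.max (left_branch 0) (left_branch 2^-1).
  by rewrite left_branch0 left_branch_half min_l ?max_r.
have [y] := IVT half0 left_branch_continuous xI.
rewrite in_itv/= => yI yx.
have : [set z | 0 <= z <= 2^-1 /\ left_branch z = x] y by split.
exact: xgetI.
Qed.

Lemma left_branch_inj x y : 0 <= x -> 0 <= y -> left_branch x = left_branch y ->
  x = y.
Proof.
move=> x0 y0 xy; case: (ltgtP x y) => // /left_branch_lt; rewrite xy ltxx.
- by move=> /(_ x0).
- by move=> /(_ y0).
Qed.

Lemma left_inverseK y : 0 <= y <= 2^-1 -> left_inverse (left_branch y) = y.
Proof.
move=> yI; have /andP[y0 y1] := yI.
have b01 : 0 <= left_branch y <= 1.
  rewrite -left_branch_half -left_branch0.
  move: y0; rewrite le_eqVlt => /predU1P[<-|y0]; move: y1.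
    by rewrite left_branch0 left_branch_half lexx ler01.
  rewrite le_eqVlt => /predU1P[->|y1].
    by rewrite left_branch0 left_branch_half lexx ler01.
  by rewrite !ltW// left_branch_lt// ltW.
have [/andP[h0 _]] := left_inverseP b01.
exact: left_branch_inj.
Qed.

Lemma left_inverse_gt0 x : 0 < x <= 1 -> 0 < left_inverse x.
Proof.
move=> /andP[x0 x1].
have [/andP[h0 _] hx] := @left_inverseP x (introT andP (conj (ltW x0) x1)).
rewrite lt_neqAle h0 andbT; apply/eqP => e.
by move: x0; rewrite -hx -e left_branch0 ltxx.
Qed.

Lemma left_inverse_le x y : 0 <= x -> x <= y -> y <= 1 ->
  left_inverse x <= left_inverse y.
Proof.
move=> x0 xy y1.
have [/andP[hx0 hx1] hx] : 0 <= left_inverse x <= 2^-1 /\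
    left_branch (left_inverse x) = x.
  by apply: left_inverseP; rewrite x0 (le_trans xy).
have [/andP[hy0 hy1] hy] : 0 <= left_inverse y <= 2^-1 /\
    left_branch (left_inverse y) = y.
  by apply: left_inverseP; rewrite y1 (le_trans x0).
by rewrite leNgt; apply/negP => /(left_branch_lt hy0); rewrite hx hy ltNge xy.
Qed.

Definition right_inverse (x : R) : R := (x + 1) / 2.

(** * Distortion of compositions of inverse branches *)

(** This is [x^(1 + alpha)], in a form that is easy to expand. *)
Definition weight (x : R) := x * x `^ alpha.

Lemma weight_gt0 x : 0 < x -> 0 < weight x.
Proof. by move=> x0; rewrite mulr_gt0 ?powR_gt0. Qed.

Lemma weight_le x y : 0 <= x -> x <= y -> weight x <= weight y.
Proof. by move=> x0 xy; rewrite ler_pM ?powR_ge0// powRW. Qed.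

Lemma weightM x y : 0 <= x -> 0 <= y -> weight (x * y) = weight x * weight y.
Proof. by move=> x0 y0; rewrite /weight powRM// mulrACA. Qed.

(** Here [dg] plays the part of the derivative of [g] on [[0, 1]]. The secant
    inequalities say that [g] is concave with supergradient [dg]; they replace
    differentiability, and they compose without any limit argument. The
    condition on [weight x * dg x] says that [g] is convex as a function of
    [- x^(- alpha)]. Concavity bounds [dg x / dg y] from below by [1] for
    [x <= y], and the second condition bounds it from above by
    [(y / x)^(1 + alpha)]. *)
Record admissible_slope (g dg : R -> R) : Prop := AdmissibleSlope {
  slope_ge0 : forall x, 0 <= x <= 1 -> 0 <= dg x ;
  slope_secant : forall x y, 0 <= x -> x <= y -> y <= 1 ->
    dg y * (y - x) <= g y - g x <= dg x * (y - x) ;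
  slope_weight : forall x y, 0 <= x -> x <= y -> y <= 1 ->
    weight x * dg x <= weight y * dg y }.

(** The last hypothesis on [h] says that [weight x * dh x / weight (h x)] is
    nondecreasing; it is cross-multiplied and restricted to [0 < x] because
    [h 0] may be [0]. Multiplied by the condition on [g] at [h x] it gives the
    condition on the composition, in which the factors [weight (h _)] cancel. *)
Lemma admissible_slope_comp (g dg h dh : R -> R) :
  (forall x, 0 <= x <= 1 -> 0 <= h x <= 1) ->
  (forall x, 0 < x <= 1 -> 0 < h x) ->
  (forall x, 0 <= x <= 1 -> 0 <= dh x) ->
  (forall x y, 0 <= x -> x <= y -> y <= 1 ->
    dh y * (y - x) <= h y - h x <= dh x * (y - x)) ->
  (forall x y, 0 < x -> x <= y -> y <= 1 ->
    weight x * dh x * weight (h y) <= weight y * dh y * weight (h x)) ->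
  admissible_slope g dg -> admissible_slope (g \o h) (fun x => dg (h x) * dh x).
Proof.
move=> h01 h_gt0 dh0 dhs hw [dg0 dgs gw].
have hle x y : 0 <= x -> x <= y -> y <= 1 -> h x <= h y.
  move=> x0 xy y1; rewrite -subr_ge0; have /andP[+ _] := dhs x y x0 xy y1.
  by apply: le_trans; rewrite mulr_ge0 ?subr_ge0// dh0// y1 (le_trans x0).
split=> [x x01|x y x0 xy y1|x y x0 xy y1].
- by rewrite mulr_ge0 ?dh0 ?dg0 ?h01.
- have xI : 0 <= x <= 1 by rewrite x0 (le_trans xy).
  have yI : 0 <= y <= 1 by rewrite y1 (le_trans x0).
  have /andP[hx0 hx1] := h01 x xI; have /andP[hy0 hy1] := h01 y yI.
  have /andP[g1 g2] := dgs (h x) (h y) hx0 (hle x y x0 xy y1) hy1.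
  have /andP[h1 h2] := dhs x y x0 xy y1.
  rewrite -!mulrA /=; apply/andP; split.
  + by apply: le_trans g1; rewrite ler_wpM2l// dg0// h01.
  + by apply: le_trans g2 _; rewrite ler_wpM2l// dg0// h01.
- have xI : 0 <= x <= 1 by rewrite x0 (le_trans xy).
  have yI : 0 <= y <= 1 by rewrite y1 (le_trans x0).
  move: (x0); rewrite le_eqVlt => /predU1P[<-|x_gt0].
    by rewrite /weight !mul0r !mulr_ge0// ?powR_ge0 ?dh0 ?dg0 ?h01 ?(le_trans x0).
  have hx0 : 0 < h x by rewrite h_gt0// x_gt0 (le_trans xy).
  have /andP[hy0 hy1] := h01 y yI.
  have hxy := hle x y x0 xy y1.
  have wx := weight_gt0 hx0.
  have wy : 0 < weight (h y) by apply: weight_gt0; exact: lt_le_trans hxy.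
  rewrite -(ler_pM2r (mulr_gt0 wx wy)).
  have := ler_pM _ _ (hw x y x_gt0 xy y1) (gw _ _ (ltW hx0) hxy hy1).
  rewrite !mulr_ge0 ?dg0 ?dh0 ?h01 ?(ltW hx0) ?(ltW wx) ?(ltW wy) ?mulr_ge0 ?powR_ge0//.
  move=> /(_ isT isT).
  move: (weight _) (weight _) (weight _) (weight _) => a b c d H.
  lra.
Qed.

(** The function [(1 + s)^(1 + alpha) / (1 + (1 + alpha) * s)] is nondecreasing:
    for [s <= t] replace [(1 + t)^(1 + alpha)] by its tangent at [1 + s]; a
    nonnegative multiple of [s * (t - s)] remains. *)
Lemma weight_slope_ratio (s t : R) : 0 <= s -> s <= t ->
  weight (1 + s) * (1 + (1 + alpha) * t) <= weight (1 + t) * (1 + (1 + alpha) * s).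
Proof.
move=> s0 st; have t0 := le_trans s0 st.
have H := powR_tangent (addr_ge0 ler01 s0) (addr_ge0 ler01 t0).
have d0 : 0 <= 1 + (1 + alpha) * s by rewrite addr_ge0// mulr_ge0// addr_ge0// ltW.
have u0 : 0 <= (1 + s) `^ alpha := powR_ge0 _ _.
have P : 0 <= (1 + s) `^ alpha * (alpha * (1 + alpha) * (s * (t - s))).
  by rewrite mulr_ge0// !mulr_ge0 ?subr_ge0 ?addr_ge0// ltW.
have := ler_wpM2r d0 H; rewrite /weight.
move: P; move: ((1 + s) `^ alpha) ((1 + t) `^ alpha) => u v P Q.
lra.
Qed.

(** At [y = left_inverse x] one has [x = y * (1 + s)] and slope
    [1 + (1 + alpha) * s] with [s = (2 * y)^alpha], so that the ratio to be
    monotone is the one of [weight_slope_ratio]. *)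
Lemma admissible_left (g dg : R -> R) : admissible_slope g dg ->
  admissible_slope (g \o left_inverse)
    (fun x => dg (left_inverse x) * (left_slope (left_inverse x))^-1).
Proof.
have half1 : (2^-1 : R) <= 1 by rewrite invf_le1// ler1n.
apply: admissible_slope_comp.
- move=> x /left_inverseP[/andP[-> h1] _]; exact: le_trans half1.
- exact: left_inverse_gt0.
- by move=> x _; rewrite invr_ge0 (le_trans ler01)// left_slope_ge1.
- move=> x y x0 xy y1.
  have [/andP[hx0 _] hx] : 0 <= left_inverse x <= 2^-1 /\
    left_branch (left_inverse x) = x.
    by apply: left_inverseP; rewrite x0 (le_trans xy).
  have [/andP[hy0 _] hy] : 0 <= left_inverse y <= 2^-1 /\
    left_branch (left_inverse y) = y.
    by apply: left_inverseP; rewrite y1 (le_trans x0).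
  have s1 := left_slope_ge1 (left_inverse x).
  have s2 := left_slope_ge1 (left_inverse y).
  rewrite ![_^-1 * _]mulrC ler_pdivrMr ?ler_pdivlMr ?(lt_le_trans ltr01)//.
  have := left_branch_secant hx0 hy0.
  have := left_branch_secant hy0 hx0.
  rewrite hx hy => A B; apply/andP; split; lra.
- move=> x y x0 xy y1.
  have [/andP[hx0 hx1] hx] : 0 <= left_inverse x <= 2^-1 /\
    left_branch (left_inverse x) = x.
    by apply: left_inverseP; rewrite ltW ?(le_trans xy).
  have [/andP[hy0 hy1] hy] : 0 <= left_inverse y <= 2^-1 /\
    left_branch (left_inverse y) = y.
    by apply: left_inverseP; rewrite y1 (le_trans (ltW x0)).
  have hxy := left_inverse_le (ltW x0) xy y1.
  have -> : weight x = weight (left_branch (left_inverse x)) by rewrite hx.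
  have -> : weight y = weight (left_branch (left_inverse y)) by rewrite hy.
  have s1 := lt_le_trans ltr01 (left_slope_ge1 (left_inverse x)).
  have s2 := lt_le_trans ltr01 (left_slope_ge1 (left_inverse y)).
  have hx_gt0 : 0 < left_inverse x.
    by rewrite left_inverse_gt0// x0 (le_trans xy).
  have hy_gt0 := lt_le_trans hx_gt0 hxy.
  move: s1 s2; move: (left_inverse x) (left_inverse y) hx_gt0 hy_gt0 hxy.
  move=> {hx hy hx0 hy0 hx1 hy1 x0 xy y1} {}x {}y x0 y0 xy sx sy.
  have st := ler_wpM2l (powR_ge0 2 alpha) (powRW (ltW x0) xy).
  have s0 := mulr_ge0 (powR_ge0 2 alpha) (powR_ge0 x alpha).
  have s0' := le_trans s0 st.
  rewrite ![weight (left_branch _)]weightM ?addr_ge0 ?(ltW x0) ?(ltW y0)//.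
  have /(ler_wpM2l (mulr_ge0 (ltW (weight_gt0 x0)) (ltW (weight_gt0 y0)))) :=
    weight_slope_ratio s0 st.
  rewrite -/(left_slope x) -/(left_slope y).
  move: (weight x) (weight y) (weight (1 + _)) (weight (1 + _)) => a b d c H.
  rewrite [leLHS]mulrAC [leRHS]mulrAC ler_pdivrMr// [leRHS]mulrAC ler_pdivlMr//.
  have -> : a * c * b * left_slope y = a * b * (c * left_slope y) by ring.
  by have -> : b * d * a * left_slope x = a * b * (d * left_slope x) by ring.
Qed.

Lemma admissible_right (g dg : R -> R) : admissible_slope g dg ->
  admissible_slope (g \o right_inverse) (fun x => dg (right_inverse x) * 2^-1).
Proof.
apply: (@admissible_slope_comp g dg right_inverse (fun=> 2^-1)).
- by move=> x; rewrite /right_inverse; lra.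
- by move=> x; rewrite /right_inverse; lra.
- by move=> *; rewrite invr_ge0.
- by move=> x y *; rewrite /right_inverse; lra.
- move=> x y x0 xy y1; rewrite mulrAC [leRHS]mulrAC ler_pM2r ?invr_gt0//.
  have rx : 0 <= right_inverse x by rewrite /right_inverse; lra.
  have ry : 0 <= right_inverse y by rewrite /right_inverse; lra.
  rewrite -!weightM// ?(ltW x0) ?(le_trans (ltW x0) xy)//.
  apply: weight_le; first by rewrite mulr_ge0// ltW.
  by rewrite /right_inverse; lra.
Qed.

Lemma admissible_id : admissible_slope id (fun=> 1).
Proof.
split=> [//|x y _ _ _|x y x0 xy y1]; first by rewrite !mul1r lexx.
by rewrite !mulr1 weight_le.
Qed.

Definition admissible (g : R -> R) := exists dg, admissible_slope g dg.

(** An upper bound on the density near [0]. Compositions of many left inverse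
    branches violate it; one further right inverse branch, applied innermost,
    restores it. *)
Definition mild_start (g : R -> R) :=
  forall a, 0 <= a <= 1 -> g a - g 0 <= 4 * a * (g 1 - g 0).

Lemma admissible_le g x y : admissible g -> 0 <= x -> x <= y -> y <= 1 ->
  g x <= g y.
Proof.
move=> [dg [dg0 dgs _]] x0 xy y1; rewrite -subr_ge0.
have /andP[+ _] := dgs x y x0 xy y1; apply: le_trans.
by rewrite mulr_ge0 ?subr_ge0// dg0// y1 (le_trans x0).
Qed.

(** By concavity, the initial segments carry at least their share of the
    increment. *)
Lemma admissible_start g a : admissible g -> 0 <= a <= 1 ->
  a * (g 1 - g 0) <= g a - g 0.
Proof.
move=> [dg [dg0 dgs _]] /andP[a0 a1].
have /andP[+ _] := dgs 0 a (lexx _) a0 a1.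
have /andP[_ +] := dgs a 1 a0 a1 (lexx _).
move/(ler_wpM2l a0) => + H.
have : 0 <= 1 - a by rewrite subr_ge0.
move=> /ler_wpM2l /(_ _ _ H); lra.
Qed.

(** The slope of the composition is at most its value at [0], a multiple of
    [dg (1 / 2)], and at least its value at [1], the same multiple of [dg 1].
    The weight condition between [1 / 2] and [1] bounds the quotient by
    [2^(1 + alpha) <= 4]. *)
Lemma mild_start_right g : admissible g -> mild_start (g \o right_inverse).
Proof.
move=> [dg ag] a /andP[a0 a1]; have := ag => -[dg0 _ gw].
have [_ gs _] := admissible_right ag.
have /andP[_ up] := gs 0 a (lexx _) a0 a1.
have /andP[low _] := gs 0 1 (lexx _) ler01 (lexx _).
have W : weight 2^-1 * dg 2^-1 <= weight 1 * dg 1 by apply: gw; lra.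
have r0 : right_inverse 0 = 2^-1 by rewrite /right_inverse; lra.
have r1 : right_inverse 1 = 1 by rewrite /right_inverse; lra.
move: up low; rewrite r0 r1 => up low.
have w1 : weight 1 = 1 by rewrite /weight powR1 mulr1.
have w2 : 4^-1 <= weight 2^-1.
  rewrite /weight (_ : 4^-1 = 2^-1 * 2^-1 :> R); last by lra.
  by rewrite ler_pM2l ?invr_gt0// ger1_powR ?ltW//; lra.
have d0 : 0 <= dg 2^-1 by apply: dg0; lra.
have Q : dg 2^-1 <= 4 * dg 1.
  have := ler_wpM2r d0 w2; rewrite w1 in W; lra.
have := ler_wpM2l a0 Q; have := ler_wpM2l a0 low; lra.
Qed.

(** * Preimages of 1 and runs in the left half *)

Definition preimage_one k : R := iter k left_inverse 1.

Lemma preimage_one_itv k : 0 <= preimage_one k <= 1.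
Proof.
have half1 : (2^-1 : R) <= 1 by rewrite invf_le1// ler1n.
elim: k => [|k IH]; first by rewrite /preimage_one/= lexx ler01.
rewrite /preimage_one iterS -/(preimage_one k).
by have [/andP[-> h] _] := left_inverseP IH; exact: le_trans half1.
Qed.

Lemma preimage_oneS k : left_branch (preimage_one k.+1) = preimage_one k.
Proof. by have [_] := left_inverseP (preimage_one_itv k). Qed.

Lemma preimage_one_gt0 k : 0 < preimage_one k.
Proof.
elim: k => [|k IH]; first exact: ltr01.
have /andP[h _] := preimage_one_itv k.+1; rewrite lt_neqAle h andbT.
by apply/eqP => e; move: IH; rewrite -preimage_oneS -e left_branch0 ltxx.
Qed.

Lemma preimage_one_le_half k : preimage_one k.+1 <= 2^-1.
Proof. by have [/andP[]] := left_inverseP (preimage_one_itv k). Qed.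

Lemma preimage_one_decr k : preimage_one k.+1 <= preimage_one k.
Proof.
rewrite -[leRHS]preimage_oneS /left_branch ler_peMr ?(ltW (preimage_one_gt0 _))//.
by rewrite lerDl mulr_ge0 ?powR_ge0.
Qed.

Lemma preimage_one_decrn : {homo preimage_one : i j / (i <= j)%N >-> j <= i}.
Proof.
by apply: homo_leq => [//|x y z xy yz|k]; [exact: le_trans yz xy|exact: preimage_one_decr].
Qed.

Lemma admissible_iter g k : admissible g -> admissible (g \o iter k left_inverse).
Proof.
elim: k g => [//|k IH] g [dg adg]; apply: (IH (g \o left_inverse)).
by eexists; exact: admissible_left adg.
Qed.

Lemma preimage_one_half k : iter k left_inverse 2^-1 = preimage_one k.+1.
Proof.
rewrite /preimage_one iterSr; congr (iter _ _ _).
have := @left_inverseK 2^-1; rewrite left_branch_half => ->//.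
by rewrite lexx invr_ge0 ler0n.
Qed.

Lemma intermittent_left x : x < 2^-1 -> T x = left_branch x.
Proof. by rewrite /intermittent => ->. Qed.

Lemma intermittent_right x : 2^-1 <= x -> right_inverse (T x) = x.
Proof. by rewrite /intermittent /right_inverse leNgt => /negbTE ->; lra. Qed.

Lemma intermittent_itv x : 0 <= x < 1 -> 0 <= T x < 1.
Proof.
move=> /andP[x0 x1]; have [xh|xh] := ltP x 2^-1.
  rewrite intermittent_left//; apply/andP; split; last first.
    by have := left_branch_lt x0 xh; rewrite left_branch_half.
  by rewrite mulr_ge0// addr_ge0// mulr_ge0// powR_ge0.
by have := intermittent_right xh; rewrite /right_inverse; lra.
Qed.

Lemma iter_intermittent_itv k x : 0 <= x < 1 -> 0 <= iter k T x < 1.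
Proof. by move=> x01; elim: k => [//|k IH]; exact: intermittent_itv. Qed.

Lemma left_inverse_iter k y : 0 <= y < 1 ->
  (forall j, (j < k)%N -> iter j T y < 2^-1) ->
  iter k left_inverse (iter k T y) = y.
Proof.
move=> y01; elim: k => [//|k IH] run; rewrite iterSr iterS.
have yk := run k (leqnn _).
rewrite intermittent_left// left_inverseK; last first.
  by rewrite (ltW yk) andbT; have /andP[] := iter_intermittent_itv k y01.
by apply: IH => j jk; apply: run; exact: ltnW.
Qed.

Definition left_run (K : nat) (x : R) :=
  forall j, (j < K)%N -> iter j T x < 2^-1.

(** For [n < K] this is all of [[0, 1)]. *)
Definition no_left_run (K n : nat) : set R :=
  [set y | 0 <= y < 1 /\ forall i, (i + K <= n)%N -> ~ left_run K (iter i T y)].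

(** The first visit to the right half occurs at some time [k < K], otherwise a
    run would start at time [0]; after that visit the orbit starts afresh, with
    [n - k.+1] positions left. *)
Lemma no_left_run_renewal K n y : (K <= n)%N -> no_left_run K n y ->
  exists2 k, (k < K)%N & exists2 z, no_left_run K (n - k.+1) z &
    y = iter k left_inverse (right_inverse z).
Proof.
move=> Kn [y01 norun].
have ex : exists k, (k < K)%N && (2^-1 <= iter k T y).
  apply: contrapT => nex; apply: (norun 0%N) => // j jK; rewrite ltNge.
  by apply/negP => h; apply: nex; exists j; rewrite jK.
have [k /andP[kK kh] kmin] := ex_minnP ex.
exists k => //; exists (iter k.+1 T y).
  split=> [|i iK run]; first exact: iter_intermittent_itv.
  apply: (norun (i + k.+1)%N); first by lia.
  by rewrite iterD.
rewrite iterS intermittent_right// left_inverse_iter// => j jk.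
rewrite ltNge; apply/negP => h.
by have := kmin j; rewrite h (ltn_trans jk kK) => /(_ isT); rewrite leqNgt jk.
Qed.

(** * Exponential bound on the set of points without a long run *)

Lemma bernoulli_le (t : R) m : 0 <= t <= 1 -> 1 - m%:R * t <= (1 - t) ^+ m.
Proof.
move=> /andP[t0 t1]; elim: m => [|m IH]; first by rewrite expr0 mul0r subr0.
have u0 : 0 <= 1 - t by lra.
rewrite exprS; apply: le_trans (ler_wpM2l u0 IH).
rewrite -natr1.
have : 0 <= m%:R * t * t :> R by rewrite !mulr_ge0.
lra.
Qed.

Lemma renewal_sum (L : nat -> R) (t : R) K :
  \sum_(k < K) (L k - L k.+1) * (1 + 2 * (k.+1%:R * t)) =
  L 0%N - L K + 2 * t * (\sum_(k < K) L k - K%:R * L K).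
Proof.
elim: K => [|K IH]; first by rewrite !big_ord0; ring.
rewrite !big_ord_recr/= IH; ring.
Qed.

(** One step of the induction. In the application, [L k] is the measure of the
    set of points that stay in the left half for [k] steps, and the sum bounds
    the measure of the points whose first visit to the right half occurs before
    time [K] and which have no run afterwards. The factors [(1 - t) ^- k.+1]
    are at most [1 + 2 * (k + 1) * t]; they cost at most [2 * t * \sum_(k < K) L k],
    hence at most [8 * t * M * L 0]; this is paid for by [L K], which is at least [a * L 0]
    and is missing from the telescoping sum. *)
Lemma renewal_bound (L : nat -> R) (t a M : R) K n :
  (0 < K <= n)%N -> 0 <= t -> K%:R * t <= 2^-1 -> 8 * t * M <= a ->
  (forall k, L k.+1 <= L k) -> (forall k, 0 <= L k) ->
  a * L 0%N <= L K -> \sum_(k < K) L k <= 4 * M * L 0%N ->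
  \sum_(k < K) (L k - L k.+1) * (1 - t) ^+ (n - k.+1) <= L 0%N * (1 - t) ^+ n.
Proof.
move=> /andP[K0 Kn] t0 Kt tM Ldecr L0 LK LM.
have t1 (k : 'I_K) : k.+1%:R * t <= 2^-1.
  by apply: le_trans Kt; rewrite ler_wpM2r// ler_nat.
have t2 : t <= 1.
  have : 1 * t <= K%:R * t by rewrite ler_wpM2r// ler1n.
  lra.
have r0 : 0 <= (1 - t) ^+ n by rewrite exprn_ge0// subr_ge0.
have step (k : 'I_K) : (L k - L k.+1) * (1 - t) ^+ (n - k.+1) <=
    (1 - t) ^+ n * ((L k - L k.+1) * (1 + 2 * (k.+1%:R * t))).
  rewrite mulrCA ler_wpM2l ?subr_ge0//.
  have kn : (k.+1 <= n)%N by exact: leq_trans (ltn_ord k) Kn.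
  rewrite -{2}(subnK kn) exprD -mulrA ler_peMr ?exprn_ge0 ?subr_ge0//.
  have t01 : 0 <= t <= 1 by rewrite t0.
  have u0 : 0 <= 1 + 2 * (k.+1%:R * t) by rewrite addr_ge0// !mulr_ge0.
  apply: le_trans (ler_wpM2r u0 (bernoulli_le k.+1 t01)).
  have := t1 k; have : 0 <= k.+1%:R * t by rewrite mulr_ge0.
  move: (_ * t) => u; nra.
apply: (le_trans (ler_sum _ (fun k _ => step k))).
rewrite -mulr_sumr mulrC ler_wpM2r// renewal_sum.
have := ler_wpM2l t0 LM; have := ler_wpM2r (L0 0%N) tM.
have : 0 <= t * K%:R * L K by rewrite !mulr_ge0.
lra.
Qed.

(** The Lebesgue expectation of the minimum of [K] and [k + 1], where [k] is the
    time of the first visit to the right half: the set of points that stay in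
    the left half for [k] steps has measure [preimage_one k]. *)
Definition preimage_sum K : R := \sum_(k < K) preimage_one k.

(** Stated for images under all [g] so that the induction hypothesis applies to
    the cylinders of the renewal decomposition, on which the position after
    the first visit to the right half is again distributed with bounded
    distortion. Measurable covers of the images are sufficient, and are built
    as finite unions of intervals. The denominator absorbs the
    case [n < K]. *)
Lemma no_left_run_cover K (t : R) : (0 < K)%N -> 0 <= t ->
  8 * t * preimage_sum K <= preimage_one K -> K%:R * t <= 2^-1 ->
  forall n g, admissible g -> mild_start g ->
  exists B : set (measurableTypeR R), [/\ measurable B,
    forall y, no_left_run K n y -> B (g y) &
    (lebesgue_measure B <= ((g 1 - g 0) * (1 - t) ^+ n / (1 - t) ^+ K)%:E)%E].
Proof.
move=> K0 t0 tM Kt.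
have t1 : t < 1.
  have : 1 * t <= K%:R * t by rewrite ler_wpM2r// ler1n.
  lra.
have r_gt0 m : 0 < (1 - t) ^+ m by rewrite exprn_gt0// subr_gt0.
elim/ltn_ind => n IH g ag mg.
have g01 : g 0 <= g 1 by apply: admissible_le.
have [nK|Kn] := ltnP n K.
  exists `[g 0, g 1]%classic; split => [|y [/andP[y0 y1] _]|].
  - exact: measurable_itv.
  - by rewrite /= in_itv/= !admissible_le// ltW.
  - rewrite lebesgue_measure_itv/= lte_fin.
    have b0 : 0 <= (g 1 - g 0) * (1 - t) ^+ n / (1 - t) ^+ K.
      by rewrite divr_ge0 ?mulr_ge0 ?subr_ge0 ?(ltW (r_gt0 _)).
    case: ifPn => _; last by rewrite lee_fin.
    rewrite -EFinB lee_fin -mulrA ler_peMr ?subr_ge0//.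
    rewrite ler_pdivlMr// mul1r -(subnK (ltnW nK)) exprD ler_piMl ?(ltW (r_gt0 _))//.
    by rewrite exprn_ile1// ?subr_ge0 ?(ltW t1)// gerBl.
pose gk k := g \o iter k left_inverse \o right_inverse.
have agk k : admissible (gk k).
  have [dg adg] := admissible_iter k ag.
  by eexists; exact: admissible_right adg.
have mgk k : mild_start (gk k) by apply: mild_start_right; exact: admissible_iter.
have nk k : (n - k.+1 < n)%N by lia.
have /choice[B HB] k := IH _ (nk k) (gk k) (agk k) (mgk k).
exists (\big[setU/set0]_(k < K) B k); split.
- by apply: bigsetU_measurable => k _; have [] := HB k.
- move=> y /(no_left_run_renewal Kn)[k kK [z zn ->]].
  rewrite -bigcup_mkord; exists k => //.
  by have [_ + _] := HB k; apply.
- apply: le_trans (Boole_inequality _ _) _; first by move=> k _; have [] := HB k.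
  have lK : (forall k, lebesgue_measure (B k) <= (((gk k 1 - gk k 0) *
      (1 - t) ^+ (n - k.+1) / (1 - t) ^+ K)%:E))%E by move=> k; have [] := HB k.
  apply: (le_trans (lee_sum _ (fun (k : 'I_K) _ => lK k))).
  rewrite sumEFin lee_fin -mulr_suml ler_pM2r ?invr_gt0//.
  (* The interval under [gk k] runs from the preimage [k.+1] to the preimage [k],
     because the right inverse branch maps 0 to 1/2 and 1 to 1. *)
  pose L k := g (preimage_one k) - g 0.
  have gkE k : gk k 1 - gk k 0 = L k - L k.+1.
    rewrite /gk /L /= /right_inverse add0r mul1r preimage_one_half.
    have -> : (1 + 1) / 2 = 1 :> R by lra.
    rewrite -/(preimage_one k); ring.
  under eq_bigr do rewrite gkE.
  have -> : g 1 - g 0 = L 0%N by [].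
  have Ig k := preimage_one_itv k.
  apply: (@renewal_bound L t (preimage_one K) (preimage_sum K)) => //.
  + by rewrite K0 Kn.
  + move=> k; rewrite lerD2r admissible_le ?preimage_one_decr//.
      by have /andP[] := Ig k.+1.
    by have /andP[] := Ig k.
  + by move=> k; have /andP[] := Ig k; rewrite subr_ge0; exact: admissible_le.
  + exact: admissible_start.
  + rewrite /preimage_sum mulr_sumr mulr_suml ler_sum// => k _; exact: mg.
Qed.

(** By monotonicity of the preimages; it shows that the rate
    [preimage_one K / (8 * preimage_sum K)] is at most [1 / (8 * K)]. *)
Lemma preimage_sum_ge K : K%:R * preimage_one K <= preimage_sum K.
Proof.
have -> : K%:R * preimage_one K = \sum_(k < K) preimage_one K.
  by rewrite sumr_const card_ord mulr_natl.
by apply: ler_sum => k _; apply: preimage_one_decrn; exact: ltnW.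
Qed.

Lemma preimage_sum_gt0 K : (0 < K)%N -> 0 < preimage_sum K.
Proof.
move=> K0; apply: lt_le_trans (preimage_sum_ge K).
by rewrite mulr_gt0 ?ltr0n// preimage_one_gt0.
Qed.

Lemma mild_start_id : mild_start id.
Proof. by move=> a /andP[a0 a1]; lra. Qed.

Lemma no_left_run_measure K : (0 < K)%N ->
  let t := preimage_one K / (8 * preimage_sum K) in
  forall n, exists B : set (measurableTypeR R), [/\ measurable B,
    no_left_run K n `<=` B & (lebesgue_measure B <= (2 * expR (- (t * n%:R)))%:E)%E].
Proof.
move=> K0 t n.
have a0 := preimage_one_gt0 K.
have Ka := preimage_sum_ge K; have M0 := preimage_sum_gt0 K0.
have t0 : 0 <= t by rewrite divr_ge0 ?mulr_ge0 ?ltW.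
have tM : 8 * t * preimage_sum K = preimage_one K.
  by rewrite /t; field; rewrite gt_eqF.
have Kt : K%:R * t <= 2^-1.
  by rewrite /t mulrA ler_pdivrMr ?mulr_gt0//; lra.
have t1 : t <= 1.
  have : 1 * t <= K%:R * t by rewrite ler_wpM2r// ler1n.
  lra.
have tM' : 8 * t * preimage_sum K <= preimage_one K by rewrite tM.
have [B [mB HB lB]] := @no_left_run_cover K t K0 t0 tM' Kt n id
  (ex_intro _ _ admissible_id) mild_start_id.
exists B; split=> //; apply: le_trans lB _; rewrite lee_fin subr0 mul1r.
have rK : 2^-1 <= (1 - t) ^+ K.
  by apply: le_trans (bernoulli_le K _); [lra|rewrite t0].
rewrite ler_pdivrMr ?(lt_le_trans _ rK) ?invr_gt0//.
have e0 := expR_ge0 (- (t * n%:R)).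
apply: (@le_trans _ _ (expR (- (t * n%:R)))); last first.
  by have := ler_wpM2l e0 rK; lra.
rewrite -[- (t * _)]mulNr expRM_natr lerXn2r ?nnegrE ?subr_ge0 ?expR_ge0//.
exact: expR_ge1Dx.
Qed.

(** * Size of the preimages and summability *)

(** Since [alpha < 1], the left branch lies above [a * (1 + 2 * a)] on
    [[0, 1 / 2]], so that the reciprocal of the preimage increases by at least [1]
    at each step. *)
Lemma preimage_one_upper k : k.+1%:R * preimage_one k <= 1.
Proof.
elim: k => [|k IH]; first by rewrite mul1r.
have a0 := preimage_one_gt0 k.+1; have a1 := preimage_one_le_half k.
move: IH; rewrite -preimage_oneS /left_branch -powRM ?(ltW a0)//.
move: (preimage_one k.+1) a0 a1 => a a0 a1.
have : 2 * a <= (2 * a) `^ alpha.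
  by apply: ger1_powR; [apply/andP; split; lra|exact: ltW].
have K0 : 0 <= k.+1%:R :> R by [].
rewrite -[k.+2%:R]natr1; move: (k.+1%:R) K0 => K K0 pa IH.
have P : K * (a * (1 + 2 * a)) <= 1.
  by apply: le_trans IH; rewrite ler_wpM2l// ler_wpM2l ?(ltW a0)// lerD2l.
have d0 : 0 < 1 + 2 * a by lra.
rewrite -(ler_pM2r d0).
have : 0 <= a * (1 - 2 * a) by rewrite mulr_ge0; lra.
lra.
Qed.

(** The power [- alpha] of the preimage increases by at most [2] at each step,
    since [(1 + s) ^ alpha <= 1 + s] and [2 ^ alpha <= 2]. *)
Lemma preimage_one_lower k : (1 + 2 * k%:R) `^ (- alpha^-1) <= preimage_one k.
Proof.
have H : 1 <= preimage_one k `^ alpha * (1 + 2 * k%:R).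
  elim: k => [|k IH]; first by rewrite powR1 mulr0 addr0 mul1r.
  have a0 := ltW (preimage_one_gt0 k.+1).
  move: IH; rewrite -preimage_oneS /left_branch.
  move: (preimage_one k.+1) a0 => a a0.
  have w0 := powR_ge0 a alpha; have c0 := powR_ge0 2 alpha.
  have c2 : 2 `^ alpha <= 2 :> R by rewrite ler1_powR ?ler1n// ltW.
  have s0 := mulr_ge0 c0 w0.
  rewrite powRM// ?addr_ge0//.
  have := @ler1_powR R (1 + 2 `^ alpha * a `^ alpha) alpha.
  rewrite lerDl s0 (ltW alpha_lt1) => /(_ isT isT).
  rewrite -[k.+1%:R]natr1.
  have K0 : 0 <= k%:R :> R by [].
  move: ((1 + 2 `^ alpha * a `^ alpha) `^ alpha) => z.
  move: (a `^ alpha) (2 `^ alpha) (k%:R) w0 c0 c2 s0 K0 => w c K w0 c0 c2 s0 K0.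
  move=> zle IH; rewrite leNgt; apply/negP => lt1.
  have P1 : w * z * (1 + 2 * K) <= w * (1 + 2 * w) * (1 + 2 * K).
    rewrite ler_wpM2r ?ler_wpM2l//; first by lra.
    have : c * w <= 2 * w by rewrite ler_wpM2r.
    lra.
  have P2 : 0 < (1 - (w * (1 + 2 * (K + 1)))) * (1 + 2 * w).
    by rewrite mulr_gt0//; lra.
  have := mulr_ge0 w0 w0; lra.
have a0 := ltW (preimage_one_gt0 k).
have k0 : 0 < 1 + 2 * k%:R :> R by rewrite ltr_wpDr ?mulr_ge0.
have -> : preimage_one k = (preimage_one k `^ alpha) `^ alpha^-1.
  by rewrite -powRrM mulfV ?gt_eqF// powRr1.
rewrite powRN -[leLHS]div1r ler_pdivrMr ?powR_gt0// -powRM ?powR_ge0 ?(ltW k0)//.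
rewrite -[leLHS](congr1 (@^~ alpha^-1) (powR1 R)).
apply: ge0_ler_powR; rewrite ?nnegrE ?invr_ge0 ?(ltW alpha_gt0)//.
exact: le_trans H.
Qed.

Lemma preimage_sum_le K : (0 < K)%N -> preimage_sum K <= 1 + ln K%:R.
Proof.
case: K => // K _; elim: K => [|K IH].
  by rewrite /preimage_sum big_ord_recr/= big_ord0 add0r ln1 addr0.
have -> : preimage_sum K.+2 = preimage_sum K.+1 + preimage_one K.+1.
  exact: big_ord_recr.
have := preimage_one_upper K.+1; move: IH.
move: (preimage_one _) (preimage_sum _) => a m IH aK.
have K2 : 0 < K.+2%:R :> R by [].
have K1 : 0 < K.+1%:R :> R by [].
have i2 : 0 < K.+2%:R^-1 :> R by rewrite invr_gt0.
have i1 : K.+2%:R^-1 < 1 :> R by rewrite invf_lt1// ltr1n.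
have a2 : a <= K.+2%:R^-1 by rewrite -[leRHS]mul1r ler_pdivlMr// mulrC.
have : -1 < - K.+2%:R^-1 :> R by rewrite ltrN2.
move=> /le_ln1Dx.
have -> : 1 + - K.+2%:R^-1 = K.+1%:R / K.+2%:R :> R.
  by rewrite -[K.+1%:R](addrK 1) natr1; field; rewrite gt_eqF.
rewrite ln_div ?posrE// => H; apply: le_trans (lerD IH a2) _.
move: H; move: (ln _) (ln _) (_^-1) => u v w; lra.
Qed.

Lemma ln_le_powR (b x : R) : 0 < b -> 1 <= x -> 1 + ln x <= (1 + b^-1) * x `^ b.
Proof.
move=> b0 x1; have x0 := lt_le_trans ltr01 x1.
have xb : 1 <= x `^ b by rewrite -(powRr0 x) ler_powR// ltW.
have := ln_sublinear (lt_le_trans ltr01 xb); rewrite ln_powR => H.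
have : ln x <= b^-1 * x `^ b by rewrite ler_pdivlMl// ltW.
lra.
Qed.

Lemma window_gt0 (b : R) n : 0 <= b -> (0 < n)%N -> (0 < window b n)%N.
Proof.
move=> b0 n0; rewrite truncn_gt0 -[leLHS](powRr0 n%:R).
by rewrite ler_powR ?ler1n.
Qed.

(** With [x = n] and [c = alpha1 / alpha], the right-hand side is at least of
    order [x^(1 - c) / (1 + ln x)]. Each logarithm is at most [D * x^d] for
    [d = (1 - c) / 4], which leaves two factors [x^d] out of the four in
    [x^(1 - c)] to beat the constant [E]. *)
Lemma run_rate_eventually (alpha1 : R) : 0 < alpha1 < alpha ->
  exists N, forall n, (N <= n)%N ->
  [/\ (0 < window alpha1 n)%N &
      2 * ln n.+2%:R <= preimage_one (window alpha1 n) /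
        (8 * preimage_sum (window alpha1 n)) * n%:R].
Proof.
move=> /andP[b0 ba].
pose c := alpha1 * alpha^-1.
have c1 : c < 1 by rewrite ltr_pdivrMr// mul1r.
pose d := (1 - c) / 4.
have d0 : 0 < d by rewrite /d; lra.
pose D := 1 + d^-1.
pose E := 32 * 3 `^ alpha^-1 * D ^+ 2.
have E0 : 0 <= E by apply: mulr_ge0; [exact: mulr_ge0 (powR_ge0 _ _)|exact: sqr_ge0].
exists (Num.truncn (E `^ (2 * d)^-1)).+2 => n Nn.
have n2 : (2 <= n)%N by exact: leq_trans Nn.
set K := window alpha1 n; set x : R := n%:R.
have x1 : 1 <= x by rewrite ler1n ltnW.
have x0 := lt_le_trans ltr01 x1.
have K0 : (0 < K)%N by rewrite window_gt0 ?ltW// ltnW.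
split=> //.
have K1 : 1 <= K%:R :> R by rewrite ler1n.
have Kx : K%:R <= x `^ alpha1 by rewrite truncn_le powR_ge0.
have Ex : E <= x `^ d * x `^ d.
  have h : E `^ (2 * d)^-1 <= x.
    apply: ltW; apply: lt_le_trans (truncnS_gt _) _.
    by rewrite ler_nat ltnW.
  have d2 : 0 < 2 * d by rewrite mulr_gt0.
  have : (E `^ (2 * d)^-1) `^ (2 * d) <= x `^ (2 * d).
    by apply: ge0_ler_powR => //; rewrite ?nnegrE ?powR_ge0 ?(ltW d2) ?(ltW x0).
  rewrite -powRrM mulVf ?gt_eqF// powRr1// => /le_trans; apply.
  by rewrite mulrDl mul1r powRD// (gt_eqF x0) implybT.
have aK : 3 `^ (- alpha^-1) * x `^ (- c) <= preimage_one K.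
  apply: le_trans (preimage_one_lower K).
  have p1 : 0 < 1 + 2 * K%:R :> R by rewrite ltr_wpDr// mulr_ge0.
  have p2 : 0 < 3 * x `^ alpha1 by rewrite mulr_gt0// powR_gt0.
  rewrite /c -mulrN powRrM -powRM ?powR_ge0// !powRN lef_pV2 ?posrE ?powR_gt0//.
  apply: ge0_ler_powR; rewrite ?nnegrE ?invr_ge0 ?(ltW alpha_gt0) ?(ltW p1) ?(ltW p2)//.
  lra.
have M0 := preimage_sum_gt0 K0.
have lnK : 1 + ln K%:R <= D * x `^ d.
  apply: le_trans (ln_le_powR d0 x1); rewrite lerD2l ler_ln ?posrE ?ltr0n ?(ltnW n2)//.
  by apply: le_trans Kx _; rewrite ler1_powR// ltW// (lt_trans ba).
have ln2 : ln n.+2%:R <= 2 * (D * x `^ d).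
  apply: (@le_trans _ _ (ln (x ^+ 2))).
    rewrite ler_ln ?posrE ?ltr0n ?exprn_gt0//.
    rewrite -natrX ler_nat -mulnn (leq_trans _ (leq_mul n2 (leqnn n)))//.
    by rewrite mul2n -addnn -addn2 leq_add2l.
  rewrite lnXn// mulr2n; have := ln_le_powR d0 x1; rewrite -/D; lra.
rewrite mulrAC ler_pdivlMr ?mulr_gt0//.
have xd0 : 0 <= x `^ d := powR_ge0 _ _.
have t0 : 0 < 3 `^ alpha^-1 :> R by rewrite powR_gt0.
have H1 : 2 * ln n.+2%:R * (8 * preimage_sum K) <=
    32 * D ^+ 2 * (x `^ d * x `^ d).
  have h1 : preimage_sum K <= D * x `^ d := le_trans (preimage_sum_le K0) lnK.
  have l0 : 0 <= ln n.+2%:R :> R by rewrite ln_ge0// ler1n.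
  have := ler_pM l0 (ltW M0) ln2 h1; lra.
apply: le_trans H1 _.
have H2 : 3 `^ (- alpha^-1) * x `^ (- c) * x <= preimage_one K * x.
  by rewrite ler_wpM2r// ltW.
apply: le_trans H2.
have -> : 3 `^ (- alpha^-1) * x `^ (- c) * x =
    3 `^ (- alpha^-1) * ((x `^ d * x `^ d) * (x `^ d * x `^ d)).
  rewrite -mulrA; congr (_ * _).
  have xn : forall r s, (r + s == 0 :> R) ==> (x != 0).
    by move=> r s; rewrite (gt_eqF x0) implybT.
  rewrite -!powRD// -[X in _ * X](powRr1 (ltW x0)) -powRD//; congr (_ `^ _).
  by rewrite /d; lra.
rewrite powRN ler_pdivlMl//.
have := ler_wpM2r (mulr_ge0 xd0 xd0) Ex; rewrite /E; lra.
Qed.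

(** The series of measures is compared with the telescoping series of
    [1 / (n + 1) - 1 / (n + 2)], which dominates [(n + 2)^-2]. *)
Lemma limsup_no_left_run_null (alpha1 : R) : 0 < alpha1 < alpha ->
  exists F : (set (measurableTypeR R))^nat, [/\ forall n, measurable (F n),
    lebesgue_measure (lim_sup_set F) = 0%E &
    exists N, forall n, (N <= n)%N -> no_left_run (window alpha1 n) n `<=` F n].
Proof.
move=> /run_rate_eventually[N HN].
pose v n : R := (n.+1%:R)^-1.
have vpos n : 0 <= v n - v n.+1.
  by rewrite subr_ge0 lef_pV2 ?posrE// ler_nat.
have H n : exists B : set (measurableTypeR R), [/\ measurable B,
    (N <= n)%N -> no_left_run (window alpha1 n) n `<=` B &
    (lebesgue_measure B <= (2 * (v n - v n.+1))%:E)%E].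
  have [nN|Nn] := ltnP n N.
    exists set0; split => //.
    by rewrite measure0 lee_fin mulr_ge0.
  have [K0 rate] := HN n Nn.
  have [B [mB sB lB]] := no_left_run_measure K0 n.
  exists B; split => //; apply: le_trans lB _.
  rewrite lee_fin ler_wpM2l//.
  apply: (@le_trans _ _ (n.+2%:R ^- 2)).
    rewrite -[n.+2%:R]lnK ?posrE// -expRM_natl -expRN ler_expR lerN2.
    by rewrite mulr_natl -mulr_natl.
  rewrite /v -subr_ge0.
  have p1 : 0 < n.+1%:R :> R by [].
  have -> : n.+2%:R = n.+1%:R + 1 :> R by rewrite natr1.
  move: (n.+1%:R) p1 => z z0.
  have -> : z^-1 - (z + 1)^-1 - (z + 1) ^- 2 = (z * (z + 1) ^+ 2)^-1.
    by field; rewrite !gt_eqF// addr_gt0.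
  by rewrite invr_ge0 mulr_ge0 ?exprn_ge0 ?addr_ge0// ltW.
have [F HF] := choice H.
exists F; split; first by move=> n; have [] := HF n.
- apply: lim_sup_set_cvg0; first by move=> n; have [] := HF n.
  apply: (@le_lt_trans _ _ 2%:E); last by rewrite ltry.
  apply: lime_le; first by apply: is_cvg_nneseries => *; exact: measure_ge0.
  apply: nearW => n.
  apply: (@le_trans _ _ (\sum_(0 <= i < n) (2 * (v i - v i.+1))%:E)%E).
    by apply: lee_sum => i _; have [] := HF i.
  rewrite sumEFin lee_fin -mulr_sumr ler_piMr//.
  under eq_bigr do rewrite -opprB.
  rewrite sumrN telescope_sumr// opprB /v invr1 gerBl invr_ge0//.
- by exists N => n Nn; have [] := HF n; auto.
Qed.

Lemma max_birkhoff_sum_left_run (K n : nat) x : 0 <= x < 1 ->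
  ~ no_left_run K n x -> max_birkhoff_sum T n K x = K%:R.
Proof.
move=> x01 nrun.
have [i iK run] : exists2 i, (i + K <= n)%N & left_run K (iter i T x).
  apply: contrapT => nex; apply: nrun; split => // i iK run.
  by apply: nex; exists i.
have le_K y : birkhoff_sum T \1_I0 K y <= K%:R :> R.
  rewrite /birkhoff_sum -[K in leRHS]card_ord -[leRHS]sumr_const.
  by apply: ler_sum => j _; rewrite indicE; case: (_ \in _).
rewrite /max_birkhoff_sum; apply/eqP; rewrite eq_le; apply/andP; split.
  by apply/bigmax_leP; split.
have iI : (i < (n - K).+1)%N by lia.
apply: le_trans (le_bigmax _ _ (Ordinal iI)) => /=.
rewrite /birkhoff_sum -[K in leLHS]card_ord -[leLHS]sumr_const.
apply: ler_sum => j _; rewrite indicE mem_set//= /I0 /= in_itv/= run// andbT.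
by rewrite -iterD; have /andP[] := iter_intermittent_itv (j + i) x01.
Qed.

End LongLeftRuns.

Theorem corollary2 (R : realType) (alpha alpha1 : R)
    (mu : probability (measurableTypeR R) R) :
  0 < alpha < 1 ->
  acip (intermittent alpha) mu ->
  0 < alpha1 < alpha ->
  {ae mu, forall x : R, x \in `[0, 1[ ->
    max_birkhoff_sum (intermittent alpha) n (window alpha1 n) x
      / (window alpha1 n)%:R @[n --> \oo] --> (1 : R)}.
Proof.
move=> /andP[alpha_gt0 alpha_lt1] [_ /null_content_dominatesP mu_ac _] alpha1I.
have [F [mF F0 [N HN]]] := limsup_no_left_run_null alpha_gt0 alpha_lt1 alpha1I.
have mL : measurable (lim_sup_set F).
  by apply: bigcap_measurable => // k _; exact: bigcup_measurable.
exists (lim_sup_set F); split => //; first exact: mu_ac.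
move=> x /= nconv; apply: contrapT => xF; apply: nconv => xI.
have [M HM] : exists M, forall n, (M <= n)%N -> ~ F n x.
  apply: contrapT => nex; apply: xF => M _.
  apply: contrapT => nF; apply: nex; exists M => n Mn Fn.
  by apply: nF; exists n.
apply: cvg_near_cst; exists (maxn (maxn M N) 1) => // n /=.
rewrite !geq_max => /andP[/andP[Mn Nn] n1].
rewrite max_birkhoff_sum_left_run//; last first.
- by move=> /(HN n Nn); exact: HM.
rewrite divff// pnatr_eq0 -lt0n window_gt0//.
by have /andP[/ltW] := alpha1I.
Qed.
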